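(* Let $n,m$ be positive integers with $m\ge n$. Let $\alpha=(a_1,\dots,a_n)\in \mathrm{PF}_{n,m}$ and let $\pi\in\mathfrak{S}_n$ act on $\alpha$ by permuting its subscripts, i.e. $\pi(\alpha)=(a_{\pi^{-1}(1)},a_{\pi^{-1}(2)},\dots,a_{\pi^{-1}(n)})$. Then $d(\alpha)=d(\pi(\alpha))$.
   Context: Write $[k]=\{1,\dots,k\}$; $\mathfrak{S}_n$ is the symmetric group on $[n]$. Parking process: there is a one-way street with $m$ spots numbered $1,\dots,m$, and $n$ cars $1,2,\dots,n$ arrive one at a time in this order. The tuple $\alpha=(a_1,\dots,a_n)\in[m]^n$ records preferences: upon arrival, car $i$ drives to spot $a_i$ and parks there if it is unoccupied; otherwise it parks in the first unoccupied spot after $a_i$, if one exists; if none exists, the parking process fails. $\mathrm{PF}_{n,m}\subseteq[m]^n$ is the set of tuples for which all $n$ cars are able to park ($(n,m)$-parking functions). This set is closed under permutation of the entries. For $\alpha\in \mathrm{PF}_{n,m}$, let $p_i$ be the spot in which car $i$ parks. The total displacement of $\alpha$ is the nonnegative integer $d(\alpha)=\sum_{i=1}^n (p_i-a_i)$. *)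

(* Defs.v *)
From HB Require Import structures.
From mathcomp Require Import all_boot all_order all_algebra all_fingroup.

Set Implicit Arguments.
Unset Strict Implicit.
Unset Printing Implicit Defensive.

Import GRing.Theory.

(* Spots and cars are numbered from 0: spot k of [m] is the ordinal of value
   k - 1 in 'I_m, and car i of [n] is the ordinal of value i - 1 in 'I_n.
   Differences p_i - a_i are unaffected by this shift. *)

(* [enum 'I_m] is increasing, so [ohead] picks the first unoccupied spot after
   [a]; [None] means that the car cannot park. *)
Definition park_car (m : nat) (occ : {set 'I_m}) (a : 'I_m) : option 'I_m :=
  if a \notin occ then Some a
  else ohead [seq s : 'I_m <- enum 'I_m | (a < s) && (s \notin occ)].

(* Cars arrive in the order of the tuple on a street whose occupied spots are
   [occ]. The i-th entry of the result is the spot of car i; the result is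
   [None] if some car cannot park. *)
Fixpoint park (m : nat) (occ : {set 'I_m}) (n : nat) :
    n.-tuple 'I_m -> option (n.-tuple 'I_m) :=
  match n return n.-tuple 'I_m -> option (n.-tuple 'I_m) with
  | 0 => fun _ => Some [tuple]
  | n'.+1 => fun alpha =>
      if park_car occ (thead alpha) is Some p then
        if @park m (p |: occ) n' (behead_tuple alpha) is Some ps
        then Some [tuple of p :: ps] else None
      else None
  end.

Definition outcome (n m : nat) (alpha : n.-tuple 'I_m) :
    option (n.-tuple 'I_m) := park set0 alpha.

Definition PF (n m : nat) : {set n.-tuple 'I_m} :=
  [set alpha | isSome (outcome alpha)].

(* The displacement is only defined on [PF n m]; it is [None] elsewhere. *)
Definition displacement (n m : nat) (alpha : n.-tuple 'I_m) : option int :=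
  if outcome alpha is Some p
  then Some (\sum_(i < n) ((tnth p i)%:Z - (tnth alpha i)%:Z))%R
  else None.

Definition perm_act (n m : nat) (pi : 'S_n) (alpha : n.-tuple 'I_m) :
    n.-tuple 'I_m := [tuple tnth alpha ((pi^-1)%g i) | i < n].

(* Main.v *)
(** Inserting one car into a set of occupied spots is an operation on sets of
    spots, and inserting a and then b gives the same set as inserting b and
    then a: either the two cars aim at different free spots and do not
    interact, or they aim at the same spot p, and whoever comes second goes to
    the first free spot after p. Hence the set of spots finally occupied
    depends only on the multiset of preferences, and the displacement is the
    sum of this set minus the sum of the preferences. *)
Require Import Defs.
From mathcomp Require Import all_boot all_order all_algebra all_fingroup.

Set Implicit Arguments.
Unset Strict Implicit.
Unset Printing Implicit Defensive.

Import GRing.Theory.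

(** Filtering keeps the list sorted, so transitivity puts its head before every other survivor. *)
Lemma ohead_filterP (T : eqType) (r : rel T) (P : pred T) (s : seq T) :
  transitive r -> sorted r s ->
  match ohead [seq x <- s | P x] with
  | Some p => [/\ p \in s, P p & {in s, forall x, P x -> (x == p) || r p x}]
  | None => {in s, forall x, ~~ P x}
  end.
Proof.
move=> r_tr /(sorted_filter r_tr P).
case def_s: [seq x <- s | P x] => [|p t] /=.
  move=> _ x xs; apply/negP => Px.
  by have := mem_filter P x s; rewrite def_s Px xs.
move/(order_path_min r_tr)/allP => p_min.
have: p \in [seq x <- s | P x] by rewrite def_s mem_head.
rewrite mem_filter => /andP[Pp ps]; split=> // x xs Px.
have: x \in [seq y <- s | P y] by rewrite mem_filter Px.
by rewrite def_s inE => /predU1P[->|/p_min ->]; rewrite ?eqxx ?orbT.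
Qed.

Section ParkCar.

Variable m : nat.
Implicit Types (occ : {set 'I_m}) (a b p q s : 'I_m).

(** Both branches of [park_car] follow one rule: take the least free spot that is at least [a]. The
    lemmas below argue from this rule alone. *)
Lemma park_carP occ a :
  match park_car occ a with
  | Some p =>
    [/\ a <= p, p \notin occ & forall s, a <= s -> s \notin occ -> p <= s]
  | None => forall s, a <= s -> s \in occ
  end.
Proof.
rewrite /park_car; case: ifPn => [a_free|]; first by split.
rewrite negbK => a_occ.
(* Since [a] is occupied, the strict search misses no free spot. *)
have gt_a s : a <= s -> s \notin occ -> a < s.
  rewrite leq_eqVlt => /predU1P[/val_inj<-|//]; by rewrite a_occ.
have lt_tr : transitive (fun s t : 'I_m => s < t).
  by move=> ? ? ?; apply: ltn_trans.
have lt_sorted : sorted (fun s t : 'I_m => s < t) (enum 'I_m).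
  by have := iota_ltn_sorted 0 m; rewrite -val_enum_ord sorted_map.
have := ohead_filterP (fun s => (a < s) && (s \notin occ)) lt_tr lt_sorted.
case: ohead => [p [_ /andP[/ltnW ap p_free] p_min]|none_free].
  split=> // s a_s s_free.
  have := p_min s; rewrite mem_enum gt_a // => /(_ isT s_free).
  by case/predU1P=> [->|/ltnW].
move=> s a_s; apply: contraT => s_free.
by have := none_free s; rewrite mem_enum gt_a // s_free => /(_ isT).
Qed.

Lemma park_car_Some occ a p :
  a <= p -> p \notin occ -> (forall s, a <= s -> s \notin occ -> p <= s) ->
  park_car occ a = Some p.
Proof.
move=> ap p_free p_min; have := park_carP occ a.
case: park_car => [q [aq q_free q_min]|/(_ p ap)].
  by congr Some; apply/val_inj/eqP; rewrite eqn_leq q_min // p_min.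
by rewrite (negPf p_free).
Qed.

Lemma park_car_None occ a :
  (forall s, a <= s -> s \in occ) -> park_car occ a = None.
Proof.
move=> full; have := park_carP occ a.
by case: park_car => // p [/full->].
Qed.

Lemma park_carU1_None occ a q :
  park_car occ a = None -> park_car (q |: occ) a = None.
Proof.
move=> Ea; have := park_carP occ a; rewrite Ea => full.
by apply: park_car_None => s /full s_occ; rewrite inE s_occ orbT.
Qed.

Lemma park_carU1_Some occ a p q :
  park_car occ a = Some p -> p != q -> park_car (q |: occ) a = Some p.
Proof.
move=> Ea neq; have := park_carP occ a; rewrite Ea => -[ap p_free p_min].
apply: park_car_Some => // [|s a_s]; rewrite !inE negb_or ?neq //.
by case/andP=> _; apply: p_min.
Qed.

(** No spot from [a] up to but excluding [p] is free, so once [p] is taken, searches from [a] and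
    from [p] see the same free spots. *)
Lemma park_carU1_same occ a p :
  park_car occ a = Some p -> park_car (p |: occ) a = park_car (p |: occ) p.
Proof.
move=> Ea; have := park_carP occ a; rewrite Ea => -[ap p_free p_min].
have after s : a <= s -> s \notin p |: occ -> p <= s.
  by move=> a_s; rewrite !inE negb_or => /andP[_]; apply: p_min.
have := park_carP (p |: occ) p.
case: (park_car _ p) => [q [pq q_free q_min]|full].
  apply: park_car_Some => // [|s a_s s_free]; first exact: leq_trans ap pq.
  exact: q_min (after s a_s s_free) s_free.
apply: park_car_None => s a_s; apply: contraT => s_free.
by rewrite -(negPf s_free); exact/full/after.
Qed.

(** This forgets which car took which spot; failure is absorbing, so the whole process becomes a
    left fold. *)
Definition fill (o : option {set 'I_m}) a : option {set 'I_m} :=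
  obind (fun occ => omap (fun p => p |: occ) (park_car occ a)) o.

Lemma fill_rcomm : right_commutative fill.
Proof.
move=> [occ|//] a b /=; rewrite /fill /=.
case Ea: (park_car occ a) => [p|]; case Eb: (park_car occ b) => [q|] //=.
- have [def_q|neq] := eqVneq p q.
    rewrite -def_q in Eb *.
    by rewrite (park_carU1_same Ea) (park_carU1_same Eb).
  by rewrite (park_carU1_Some Ea) // (park_carU1_Some Eb) 1?eq_sym //= setUCA.
(* A car that cannot park still cannot after another has parked, so both orders fail. *)
- by rewrite park_carU1_None.
- by rewrite park_carU1_None.
Qed.

Lemma foldl_fill_None (s : seq 'I_m) : foldl fill None s = None.
Proof. by elim: s. Qed.

(** Each newly taken spot moves from the second sum into the first; it was free, so it is counted
    once. *)
Lemma sum_park occ n (alpha : n.-tuple 'I_m) :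
  omap (fun ps : n.-tuple 'I_m => \sum_(x in occ) x + \sum_(x <- ps) x)
    (park occ alpha)
  = omap (fun F : {set 'I_m} => \sum_(x in F) x) (foldl fill (Some occ) alpha).
Proof.
elim: n => [|n IHn] in occ alpha *.
  by rewrite tuple0 /= big_nil addn0.
case/tupleP: alpha => a alpha /=; rewrite theadE.
have := park_carP occ a; rewrite /fill /=.
case: park_car => [p [_ p_free _]|_] /=; last by rewrite foldl_fill_None.
have -> : behead_tuple [tuple of a :: alpha] = alpha by apply: val_inj.
rewrite -IHn; case: park => //= ps.
by rewrite big_cons big_setU1 //= addnCA addnA.
Qed.

End ParkCar.

Lemma foldl_perm_eq (T : eqType) (R : Type) (f : R -> T -> R) (z : R)
    (s t : seq T) :
  right_commutative f -> perm_eq s t -> foldl f z s = foldl f z t.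
Proof.
move=> fC; elim: s z t => [|x s IHs] z t.
  by rewrite perm_sym => /perm_nilP->.
move=> st; have := perm_mem st x; rewrite mem_head => /esym xt.
(* Repeated swaps carry the last entry to the front. *)
have foldlC u y : foldl f z (rcons u y) = foldl f z (y :: u).
  elim: u z {xt st IHs} => //= w u IHu z.
  by rewrite IHu /= fC.
case/splitPr: xt st => t1 t2; rewrite perm_sym perm_catC /= perm_cons.
rewrite perm_catC perm_sym => /IHs/= ->.
by rewrite -cat_rcons !foldl_cat foldlC.
Qed.

Lemma displacementE n m (alpha : n.-tuple 'I_m) :
  displacement alpha =
  omap (fun F : {set 'I_m} =>
          ((\sum_(x in F) x)%:Z - (\sum_(x <- alpha) x)%:Z)%R)
    (foldl (@fill m) (Some set0) alpha).
Proof.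
have := sum_park set0 alpha; rewrite /displacement /outcome.
(* The identity of [sum_park] makes both sides succeed or fail together. *)
case: park => [ps|]; case: foldl => //= F [].
rewrite big_set0 add0n => <-; congr Some.
by rewrite sumrB !big_tuple !(big_morph Posz PoszD (erefl _)).
Qed.

Lemma perm_eq_perm_act n m (pi : 'S_n) (alpha : n.-tuple 'I_m) :
  perm_eq alpha (perm_act pi alpha).
Proof.
(* [perm_act] reads [alpha] at [pi^-1], hence the witness. *)
rewrite perm_sym; apply/tuple_permP; by exists (pi^-1)%g.
Qed.

Theorem theorem3p2 (n m : nat) (n_gt0 : 0 < n) (m_gt0 : 0 < m) (le_nm : n <= m)
    (alpha : n.-tuple 'I_m) (alphaPF : alpha \in PF n m) (pi : 'S_n) :
  displacement alpha = displacement (perm_act pi alpha).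
Proof.
have eq_alpha := perm_eq_perm_act pi alpha.
rewrite !displacementE (foldl_perm_eq _ (@fill_rcomm m) eq_alpha).
by rewrite (perm_big _ eq_alpha).
Qed.
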